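(* Let $p$ be a prime, let $\lambda_1\geq\lambda_2\geq\lambda_3\geq 1$ be integers and let $G_{\lambda}=\mathbb{Z}_{p^{\lambda_1}}\times\mathbb{Z}_{p^{\lambda_2}}\times\mathbb{Z}_{p^{\lambda_3}}$. Then $$|\mathcal{E}_{p^i}(G_{\lambda})| = \begin{cases} \dfrac{p^{2i-1}\left((i+1)p^4+(i-1)p^3-p^2-(i+2)p-i\right)+3}{(p^2-1)(p-1)}, & 1\leq i\leq\lambda_3,\\[3mm] \dfrac{(\lambda_3+1)p^{\lambda_3+i}(p^2-1)(p+1)-2p^{2\lambda_3+2}+2}{(p^2-1)(p-1)}, & \lambda_3<i\leq\lambda_2,\\[3mm] \dfrac{(\lambda_3+1)p^{\lambda_2+\lambda_3+1}(p^2-1)-p^{2\lambda_3+2}+1}{(p^2-1)(p-1)}, & \lambda_2<i\leq\lambda_1. \end{cases}$$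
   Context: $\mathbb{Z}_n$ denotes the cyclic group of order $n$. For a finite abelian group $G$ and a positive integer $d$, $\mathcal{E}_d(G)=\{H\leq G : \exp(H)=d\}$ is the set of subgroups of $G$ whose exponent is exactly $d$. *)

(* Defs.v *)
From mathcomp Require Import all_boot all_order all_algebra all_fingroup all_solvable.

Set Implicit Arguments.
Unset Strict Implicit.
Unset Printing Implicit Defensive.

Import GroupScope.

Definition subgroups_of_exponent (gT : finGroupType) (G : {group gT}) (d : nat)
    : {set {group gT}} :=
  [set H : {group gT} | (H \subset G) && (exponent H == d)].

(* For n >= 2, 'Z_n carries the cyclic group of order n (its additive group);
   'Z_0 and 'Z_1 would denote the group of order 2, so the l_k must be positive
   for this to be Z_(p^l1) x Z_(p^l2) x Z_(p^l3). *)
Definition Glambda (p l1 l2 l3 : nat) : finGroupType :=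
  ('Z_(p ^ l1) * 'Z_(p ^ l2) * 'Z_(p ^ l3))%type.

(* Main.v *)
Require Import Defs.
From mathcomp Require Import all_boot all_order all_algebra all_fingroup all_solvable.
From mathcomp Require Import ring.

Set Implicit Arguments.
Unset Strict Implicit.
Unset Printing Implicit Defensive.

Import GRing.Theory.

(** Everything reduces to one recursion. Put Z_k(G) = sum of |G : H|^k over the
    subgroups H of G (index_sum), so that Z_0 counts subgroups. Let
    G = A \x <[x]> be abelian, with x of order p^(n+1) and exp(A) dividing
    p^(n+1). Then (index_sum_rec)
<<
      Z_k(A \x <[x]>) = p^k Z_k(A \x <[x^p]>) + Z_(k+1)(A).
>>
    The first term collects the H inside A \x <[x^p]>, a subgroup of index p. Any
    other H contains a x for some a in A, and in fact for exactly |A :&: H| such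
    a (card_translates). Conversely, fix a in A: because exp(A) divides the order
    of x, <[a x]> is again a complement of A (dprod_shear), so the subgroups
    containing a x correspond to the subgroups B = A :&: H of A, with
    |G : H| = |A : B| (index_sum_complement). Counting the pairs (a, H) with
    weight |G : H|^(k+1) in both ways gives |A| times the second term.

    The recursion gives Z_2 of a cyclic group, a geometric sum, and from it Z_1 of
    a group of rank 2 in closed form (index_sum1_rank2). For k = 0 and rank 3 it
    says that replacing x by x^p, with x a generator of maximal order, loses
    exactly Z_1 of the product of the two other factors (index_sum0_drop).

    Finally the subgroups of exponent p^(n+1) are those contained in
    'Ohm_n.+1(G) but not in 'Ohm_n(G), and passing from the former to the latter
    replaces by their p-th powers the generators of order p^(n+1): three, two or
    one of them in the three cases of the theorem. Each replacement is made when
    the generator concerned has maximal order, so the answer is a sum of three,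
    two or one values of Z_1 in rank 2 (card_exponent_rank3). *)

(** * Subgroup sums and their recursion *)

Section SubgroupSums.
Local Open Scope group_scope.

Implicit Types gT : finGroupType.

Definition index_sum gT (k : nat) (G : {set gT}) : nat :=
  \sum_(H : {group gT} | H \subset G) #|G : H| ^ k.

Lemma index_sum1 gT k : index_sum k [1 gT] = 1%N.
Proof.
rewrite /index_sum (big_pred1 1%G) => [|H]; first by rewrite indexgg exp1n.
by rewrite subG1; apply/eqP/eqP => [/val_inj | ->].
Qed.

Lemma dprod_sub gT (A B A' B' G : {group gT}) :
  A \x B = G -> A' \subset A -> B' \subset B -> A' \x B' = A' <*> B'.
Proof.
case/dprodP=> _ _ cAB tiAB sA'A sB'B; apply: dprodEY.
  exact: subset_trans sB'B (subset_trans cAB (centS sA'A)).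
by apply/trivgP; rewrite -tiAB setISS.
Qed.

(** The subgroups H containing a complement <[y]> of A are the B <*> <[y]> with
    B = A :&: H, by the modular law, and |H| = |B| #[y] gives |G : H| = |A : B|. *)
Lemma index_sum_complement gT (A G : {group gT}) (y : gT) (k : nat) :
    A \x <[y]> = G ->
  \sum_(H : {group gT} | (H \subset G) && (y \in H)) #|G : H| ^ k
    = index_sum k A.
Proof.
move=> defG; have [_ defAy cAy tiAy] := dprodP defG.
rewrite (reindex_onto (fun B : {group gT} => B <*> <[y]>)%G
                      (fun H : {group gT} => A :&: H)%G) /=; last first.
  move=> H /andP[sHG Hy]; apply/val_inj => /=.
  have cAHy : <[y]> \subset 'C(A :&: H).
    by rewrite (subset_trans cAy) ?centS ?subsetIl.
  rewrite -[RHS](setIidPl sHG) -defAy -group_modr ?cycle_subG // (setIC H A).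
  exact: cent_joinEr cAHy.
apply: eq_big => [B | B].
  apply/idP/idP=> [/andP[_ /eqP <-] | sBA]; first exact: subsetIl.
  have defBy := dprod_sub defG sBA (subxx _).
  have [_ defB' cBy _] := dprodP defBy.
  have yB : y \in B <*> <[y]> by rewrite -cycle_subG joing_subr.
  rewrite yB -(dprodWY defG) genS ?setSU //=; apply/eqP/val_inj => /=.
  by rewrite -defB' setIC -group_modl // setIC tiAy mulg1.
case/andP=> _ /eqP defB; have sBA : B \subset A by rewrite -defB subsetIl.
have defBy := dprod_sub defG sBA (subxx _).
congr (_ ^ _)%N; rewrite /= -!divgS //; last by rewrite -(dprodWY defG) genS ?setSU.
by rewrite -(dprod_card defG) -(dprod_card defBy) divnMr ?cardG_gt0.
Qed.

(** An element of A :&: <[a * x]> is (a * x)^m with x^m = 1; then #[x], hence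
    exponent A, divides m, and a^m = 1 as well. *)
Lemma dprod_shear gT (A G : {group gT}) (a x : gT) :
    abelian G -> exponent A %| #[x] -> A \x <[x]> = G -> a \in A ->
  A \x <[a * x]> = G.
Proof.
move=> cGG expA defG Aa; have [_ defAx cAx tiAx] := dprodP defG.
have sAG : A \subset G by rewrite -defAx mulG_subl.
have Gx : x \in G by rewrite -cycle_subG -defAx mulG_subr.
have cax : commute a x by apply: (centsP cGG) => //; apply: (subsetP sAG).
have tiAy : A :&: <[a * x]> = 1.
  apply/trivgP/subsetP=> y /setIP[Ay /cycleP[m Dy]].
  rewrite Dy expgMn // in Ay *.
  have /set1P xm1 : x ^+ m \in [1].
    by rewrite -tiAx inE mem_cycle andbT -(groupMl _ (groupX m Aa)).
  have eAm : exponent A %| m by rewrite (dvdn_trans expA) // order_dvdn xm1.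
  by rewrite xm1 mulg1 (exponentP eAm) // set11.
have Gax : a * x \in G by rewrite groupM // (subsetP sAG).
have cAy : <[a * x]> \subset 'C(A).
  by rewrite cycle_subG; apply: (subsetP (centS sAG)); apply: (subsetP cGG).
rewrite dprodEY //; apply/eqP; rewrite eqEsubset join_subG sAG cycle_subG Gax /=.
rewrite -defAx mul_subG ?joing_subl // cycle_subG -{1}[x](mulKg a).
rewrite groupMl ?groupV; first by rewrite -cycle_subG joing_subr.
exact: subsetP (joing_subl _ _) _ Aa.
Qed.

(** If some a * x lies in H and H is inside G', then G' contains A and x, so it is
    G. If H is not inside G', it contains some b * x^m with m prime to p, and a
    power of that element has the form c * x with c in A. The a in A with a * x
    in H then form the coset of A :&: H through c. *)
Lemma card_translates gT (A G G' H : {group gT}) (x : gT) (p n : nat) :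
    prime p -> abelian G -> #[x] = (p ^ n.+1)%N ->
    A \x <[x]> = G -> A \x <[x ^+ p]> = G' -> ~~ (G \subset G') -> H \subset G ->
  #|[set a in A | a * x \in H]| = if H \subset G' then 0%N else #|A :&: H|.
Proof.
move=> p_pr cGG ox defG defG' nsGG' sHG; have [_ defAx cAx tiAx] := dprodP defG.
have sAG : A \subset G by rewrite -defAx mulG_subl.
have Gx : x \in G by rewrite -cycle_subG -defAx mulG_subr.
have notin_G' a : a \in A -> a * x \notin G'.
  move=> Aa; apply: contra nsGG' => G'ax.
  have sAG' : A \subset G' by rewrite -(dprodW defG') mulG_subl.
  rewrite -defAx mul_subG // cycle_subG.
  by rewrite -(groupMl _ (subsetP sAG' _ Aa)).
case: ifPn => [sHG' | /subsetPn[h Hh G'h]].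
  apply/eqP; rewrite cards_eq0; apply/eqP/setP => a; rewrite !inE.
  apply/negP => /andP[Aa /(subsetP sHG')].
  exact/negP/notin_G'.
have [b Ab [m Dh]] : exists2 b, b \in A & exists m, h = b * x ^+ m.
  have := subsetP sHG h Hh; rewrite -defAx => /mulsgP[b _ Ab /cycleP[m ->] ->].
  by exists b => //; exists m.
have co_xm : coprime #[x] m.
  rewrite ox coprimeXl // prime_coprime //; apply: contra G'h => /dvdnP[r Dm].
  by rewrite Dh Dm mulnC expgM -(dprodW defG') mem_mulg ?mem_cycle.
have /cycleP[r Dx] : x \in <[x ^+ m]>.
  by move: co_xm; rewrite -generator_coprime => /eqP <-; apply: cycle_id.
have Hc : b ^+ r * x \in H.
  have cbx : commute b (x ^+ m).
    by apply: (centsP cGG); rewrite ?groupX // (subsetP sAG).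
  have -> : b ^+ r * x = h ^+ r by rewrite Dh expgMn // -Dx.
  exact: groupX.
set c := b ^+ r in Hc; have Ac : c \in A by rewrite groupX.
rewrite -(card_rcoset (A :&: H) c); apply: eq_card => a.
rewrite mem_rcoset !inE (groupMr a (groupVr Ac)); congr (_ && _).
by rewrite -(groupMr (a * c^-1) Hc) mulgA mulgKV.
Qed.

Lemma index_sum_rec gT (A G G' : {group gT}) (x : gT) (p n k : nat) :
    prime p -> abelian G -> #[x] = (p ^ n.+1)%N -> exponent A %| p ^ n.+1 ->
    A \x <[x]> = G -> A \x <[x ^+ p]> = G' ->
  index_sum k G = (p ^ k * index_sum k G' + index_sum k.+1 A)%N.
Proof.
move=> p_pr cGG ox expA defG defG'.
have sAG : A \subset G by rewrite -(dprodW defG) mulG_subl.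
have sG'G : G' \subset G.
  by rewrite -(dprodW defG) -(dprodW defG') mulgS ?cycleX.
have iG'G : #|G : G'| = p.
  rewrite -divgS // -(dprod_card defG) -(dprod_card defG') divnMl ?cardG_gt0 //.
  rewrite -![#|<[_]>|]/(#[_]) orderXdiv ox ?expnS ?dvdn_mulr //.
  by rewrite mulKn ?prime_gt0 // mulnK // expn_gt0 prime_gt0.
have defAy a : a \in A -> A \x <[a * x]> = G.
  by apply: dprod_shear; rewrite ?ox.
have nsGG' : ~~ (G \subset G').
  by rewrite -indexg_eq1 iG'G gtn_eqF ?prime_gt1.
have card_fib (H : {group gT}) (sHG : H \subset G) :=
  card_translates p_pr cGG ox defG defG' nsGG' sHG.
rewrite {1}/index_sum (bigID (fun H : {group gT} => H \subset G')) /=.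
congr (_ + _)%N.
  rewrite /index_sum big_distrr /=; apply: eq_big => H.
    by apply: andb_idl => sHG'; apply: subset_trans sG'G.
  by case/andP=> _ sHG'; rewrite -(Lagrange_index sG'G sHG') expnMn iG'G.
(* Multiplied by #|A|, both sides count pairs (a, H) with weight |G : H|^k.+1. *)
apply/eqP; rewrite -(eqn_pmul2l (cardG_gt0 A)); apply/eqP.
transitivity (\sum_(H : {group gT} | H \subset G)
    \sum_(a in A | (a * x)%g \in H) #|G : H| ^ k.+1)%N.
  rewrite big_distrr big_mkcondr /=; apply: eq_bigr => H sHG.
  have -> : (\sum_(a in A | (a * x)%g \in H) #|G : H| ^ k.+1 =
      #|[set a in A | (a * x)%g \in H]| * #|G : H| ^ k.+1)%N.
    by rewrite -sum_nat_const; apply: eq_bigl => a; rewrite inE.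
  rewrite card_fib //; case: (boolP (H \subset G')) => //= nsHG'.
  have : (0 < #|[set a in A | (a * x)%g \in H]|)%N.
    by rewrite card_fib // (negPf nsHG') cardG_gt0.
  case/card_gt0P=> a /setIdP[Aa Hax].
  have defH : A * H = G.
    apply/eqP; rewrite eqEsubset mul_subG //= -(dprodW (defAy a Aa)).
    by rewrite mulgS // cycle_subG.
  suff -> : #|A| = (#|A :&: H| * #|G : H|)%N by rewrite -mulnA -expnS.
  have := mul_cardG A H; rewrite defH -(Lagrange sHG) => E.
  apply/eqP; rewrite -(eqn_pmul2r (cardG_gt0 H)) E; apply/eqP; ring.
rewrite (exchange_big_dep (mem A)) /=; last by move=> H a _ /andP[].
rewrite -sum_nat_const; apply: eq_bigr => a Aa.
rewrite -(index_sum_complement k.+1 (defAy a Aa)).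
by apply: eq_bigl => H; rewrite Aa.
Qed.

(** * Subgroups of a given exponent and the groups Ohm *)

(** In an abelian p-group, 'Ohm_m(G) consists of the elements killed by p^m, so
    the subgroups it contains are those whose exponent divides p^m. *)
Lemma card_subgroups_of_exponent gT (G : {group gT}) (p n : nat) :
    prime p -> p.-group G -> abelian G ->
  (#|subgroups_of_exponent G (p ^ n.+1)| + index_sum 0 'Ohm_n(G)
     = index_sum 0 'Ohm_n.+1(G))%N.
Proof.
move=> p_pr pG cGG.
have sub_Ohm m (H : {group gT}) :
    (H \subset 'Ohm_m(G)) = (H \subset G) && (exponent H %| p ^ m)%N.
  rewrite (OhmEabelian pG) ?(abelianS (Ohm_sub _ _)) // subsetI; congr (_ && _).
  apply/subsetP/exponentP => eH x /eH; rewrite ?inE; first by move/eqP.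
  by move->.
pose D m := [set H : {group gT} | (H \subset G) && (exponent H %| p ^ m)%N].
have card_Ohm m : index_sum 0 'Ohm_m(G) = #|D m|.
  by rewrite -sum1_card; apply: eq_big => [H | //]; rewrite inE sub_Ohm.
rewrite !card_Ohm -(cardsID (D n) (D n.+1)) addnC.
congr (_ + _)%N; apply: eq_card => H.
  rewrite !inE -andbA; case: (H \subset G) => //=.
  by rewrite andb_idl // => /dvdn_trans; apply; apply: dvdn_exp2l.
rewrite !inE; case: (H \subset G) => //=.
apply/eqP/andP=> [-> | [ndv /(dvdn_pfactor _ _ p_pr)[m le_mn Dm]]].
  by rewrite dvdnn dvdn_Pexp2l ?prime_gt1 // ltnn.
move: ndv; rewrite Dm dvdn_Pexp2l ?prime_gt1 // -ltnNge => lt_nm.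
by congr (_ ^ _)%N; apply/eqP; rewrite eqn_leq le_mn.
Qed.

Lemma Ohm_cycle_small gT (x : gT) p l n :
    prime p -> #[x] = (p ^ l)%N -> (l <= n)%N -> 'Ohm_n(<[x]>) = <[x]>.
Proof.
move=> p_pr ox le_ln; rewrite (@Ohm_p_cycle n gT p) ?/p_elt ?ox ?pnatX ?pnat_id //.
by rewrite pfactorK // (eqP le_ln) expg1.
Qed.

Lemma Ohm_cycle_large gT (x : gT) p l n :
    prime p -> #[x] = (p ^ l)%N -> (n < l)%N ->
  exists y, [/\ 'Ohm_n.+1(<[x]>) = <[y]>, 'Ohm_n(<[x]>) = <[y ^+ p]>
               & #[y] = (p ^ n.+1)%N].
Proof.
move=> p_pr ox lt_nl; exists (x ^+ (p ^ (l - n.+1))).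
have px : p.-elt x by rewrite /p_elt ox pnatX pnat_id.
rewrite !(Ohm_p_cycle _ px) ox pfactorK // (orderXexp _ ox) subKn //; split=> //.
by rewrite -expgM -expnSr subnSK.
Qed.

Lemma order_exp_p gT (x : gT) p n :
  prime p -> #[x] = (p ^ n.+1)%N -> #[x ^+ p] = (p ^ n)%N.
Proof.
by move=> p_pr ox; rewrite orderXdiv ox ?expnS ?dvdn_mulr // mulKn ?prime_gt0.
Qed.

Lemma abelian_dprod gT (A B G : {group gT}) :
  A \x B = G -> abelian A -> abelian B -> abelian G.
Proof.
by case/dprodP=> _ <- cAB _ cAA cBB; rewrite abelianM cAA cBB.
Qed.

End SubgroupSums.

(** * Closed forms in rank 1 and 2 *)

Section ClosedForms.
Local Open Scope group_scope.
Local Open Scope ring_scope.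

Implicit Types gT : finGroupType.

Lemma index_sum2_cycle gT (x : gT) (p n : nat) :
    prime p -> #[x] = (p ^ n)%N ->
  (index_sum 2 <[x]>)%:R * (p%:R ^+ 2 - 1) = p%:R ^+ (2 * n + 2) - 1 :> rat.
Proof.
move=> p_pr; elim: n x => [|n IHn] x ox.
  have /eqP -> : x == 1%g by rewrite -order_eq1 ox.
  by rewrite cycle1 index_sum1 mul1r.
have oxp := order_exp_p p_pr ox.
rewrite (@index_sum_rec _ 1%G <[x]>%G <[x ^+ p]>%G x p n) ?dprod1g ?cycle_abelian
        ?exponent1 ?dvd1n //=.
rewrite index_sum1 natrD natrM natrX mulrDl -mulrA (IHn _ oxp).
rewrite (_ : 2 * n.+1 + 2 = 2 + (2 * n + 2))%N ?mulnS //.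
by rewrite (exprD _ 2 (2 * n + 2)); ring.
Qed.

(** At q = p and for c <= b, this is Z_1 of a product of cyclic groups of orders
    p^b and p^c. The formula is not symmetric in b and c. *)
Definition rank2_sum (q : rat) (b c : nat) : rat :=
  ((c%:R + 1) * q ^+ (b + c + 1) * (q ^+ 2 - 1) - q ^+ (2 * c + 2) + 1)
    / ((q ^+ 2 - 1) * (q - 1)).

Lemma denom_neq0 p : prime p ->
  (p%:R : rat) ^+ 2 - 1 != 0 /\ (p%:R : rat) - 1 != 0.
Proof.
move=> /prime_gt1 p_gt1; rewrite !subr_eq0 -natrX !Num.Theory.pnatr_eq1.
by rewrite !gtn_eqF // -[1%N](exp1n 2) ltn_exp2r.
Qed.

(** The recursion lowers the larger exponent a. When a = b it leads to the pair
    (a - 1, a), and the two factors are exchanged to restore the order that the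
    closed form requires. *)
Lemma index_sum1_rank2 gT (x y : gT) (G : {group gT}) (p a b : nat) :
    prime p -> abelian G -> #[x] = (p ^ a)%N -> #[y] = (p ^ b)%N ->
    (b <= a)%N -> (<[x]> \x <[y]> = G)%g ->
  (index_sum 1 G)%:R = rank2_sum p%:R a b.
Proof.
move=> p_pr; have [q2 q1] := denom_neq0 p_pr.
have [n] := ubnP (a + b)%N.
elim: n x y a b G => // n IHn x y [|a] b G le_ab_n cGG ox oy le_ba defG.
  move: le_ba oy; rewrite leqn0 => /eqP -> oy.
  have /eqP x1 : x == 1%g by rewrite -order_eq1 ox.
  have /eqP y1 : y == 1%g by rewrite -order_eq1 oy.
  have -> : (G : {set gT}) = 1%g by rewrite -defG x1 y1 cycle1 dprod1g.
  rewrite index_sum1 /rank2_sum; field.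
  by rewrite q1.
have oxp := order_exp_p p_pr ox.
move: defG; rewrite dprodC => defG.
have defG' := dprod_sub defG (subxx _) (cycleX x p).
have cG'G' : abelian (<[y]> <*> <[x ^+ p]>)%g.
  by apply: abelianS cGG; rewrite -(dprodWY defG) genS ?setUS ?cycleX.
rewrite (@index_sum_rec _ <[y]>%G G (<[y]> <*> <[x ^+ p]>)%G x p a) //; last first.
  by rewrite exponent_cycle oy dvdn_exp2l.
rewrite natrD natrM expn1.
have -> : (index_sum 2 <[y]>)%:R
    = (p%:R ^+ (2 * b + 2) - 1) / (p%:R ^+ 2 - 1) :> rat.
  by rewrite -(index_sum2_cycle p_pr oy) mulfK.
have [le_ba' | lt_ab] := leqP b a.
  rewrite (IHn (x ^+ p)%g y a b) //; last by rewrite dprodC.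
  rewrite /rank2_sum !addSn !exprS; field.
  by rewrite q1.
have Db : b = a.+1 by apply/eqP; rewrite eqn_leq le_ba.
rewrite Db in oy le_ab_n *.
rewrite (IHn y (x ^+ p)%g a.+1 a) //; last by rewrite addSn addnC in le_ab_n *.
rewrite /rank2_sum -[a.+1%:R]natr1.
(* Expand every power into p, p^a and numerals, the atoms known to field. *)
rewrite !mul2n -!addnn !addnS !addSn !addn0 !exprS !exprD.
by field; rewrite q1.
Qed.

(** * Rank 3 *)

(** The condition c <= b <= a.+1 says that x has maximal order, as the recursion
    on x requires, and orders the two other factors as in rank2_sum. *)
Lemma index_sum0_drop gT (x y z : gT) (G : {group gT}) (p a b c : nat) :
    prime p -> abelian G ->
    #[x] = (p ^ a.+1)%N -> #[y] = (p ^ b)%N -> #[z] = (p ^ c)%N ->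
    (c <= b)%N -> (b <= a.+1)%N -> <[x]> \x <[y]> \x <[z]> = G ->
  exists G' : {group gT},
    [/\ <[(x ^+ p)%g]> \x <[y]> \x <[z]> = G', abelian G'
      & (index_sum 0 G)%:R = (index_sum 0 G')%:R + rank2_sum p%:R b c].
Proof.
move=> p_pr cGG ox oy oz le_cb le_ba; rewrite -dprodA dprodC => defG.
have [[A _ defA _] _ _ _] := dprodP defG.
rewrite defA in defG.
have defG' := dprod_sub defG (subxx _) (cycleX x p).
have cG'G' : abelian (A <*> <[(x ^+ p)%g]>).
  by apply: abelianS cGG; rewrite -(dprodWY defG) genS ?setUS ?cycleX.
exists (A <*> <[(x ^+ p)%g]>)%G; split=> //.
  by rewrite -dprodA dprodC defA.
have cAA : abelian A.
  by apply: abelianS cGG; rewrite -(dprodW defG) mulG_subl.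
rewrite (@index_sum_rec _ A G (A <*> <[(x ^+ p)%g]>)%G x p a) //; last first.
  rewrite -(dprod_exponent defA) !exponent_cycle oy oz dvdn_lcm.
  by rewrite !dvdn_exp2l // (leq_trans le_cb).
by rewrite natrD mul1n (index_sum1_rank2 p_pr cAA oy oz).
Qed.

(** The generators of 'Ohm_n.+1(G) of order p^n.+1 are replaced one after the
    other by their p-th powers. The factors are permuted between two steps so
    that the next generator comes first and the two others stand in decreasing
    order, as index_sum0_drop requires. *)
Lemma card_exponent_rank3 gT (x y z : gT) (G : {group gT}) (p l1 l2 l3 n : nat) :
    prime p ->
    #[x] = (p ^ l1)%N -> #[y] = (p ^ l2)%N -> #[z] = (p ^ l3)%N ->
    (l3 <= l2)%N -> (l2 <= l1)%N -> <[x]> \x <[y]> \x <[z]> = G ->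
  let N : rat := #|subgroups_of_exponent G (p ^ n.+1)|%:R in
  let s := rank2_sum p%:R in
  [/\ (n < l3)%N -> N = s n.+1 n.+1 + s n.+1 n + s n n,
      (l3 <= n < l2)%N -> N = s n.+1 l3 + s n l3
    & (l2 <= n < l1)%N -> N = s l2 l3].
Proof.
move=> p_pr ox oy oz le32 le21 defG N s.
have cGG : abelian G.
  have [[A _ defA _] _ _ _] := dprodP defG.
  rewrite defA in defG.
  apply: (abelian_dprod defG) (cycle_abelian z).
  exact: (abelian_dprod defA) (cycle_abelian x) (cycle_abelian y).
have pG : p.-group G.
  have [[A _ defA _] _ _ _] := dprodP defG.
  rewrite defA in defG.
  rewrite /pgroup -(dprod_card defG) -(dprod_card defA) !pnatM.
  by rewrite -!/(order _) ox oy oz !pnatX !pnat_id.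
have ENat := card_subgroups_of_exponent n p_pr pG cGG.
have cOO : abelian 'Ohm_n.+1(G) by apply: abelianS cGG; apply: Ohm_sub.
have E : N = (index_sum 0 'Ohm_n.+1(G))%:R - (index_sum 0 'Ohm_n(G))%:R.
  by rewrite -ENat natrD addrK.
have defO m : 'Ohm_m(<[x]>) \x 'Ohm_m(<[y]>) \x 'Ohm_m(<[z]>) = 'Ohm_m(G).
  have [[A _ defA _] _ _ _] := dprodP defG.
  rewrite defA in defG.
  by rewrite (Ohm_dprod m defA) (Ohm_dprod m defG).
have [defO0 defO1] := (defO n, defO n.+1).
split=> [lt_n3 | /andP[le3n lt_n2] | /andP[le2n lt_n1]]; rewrite {}E.
- have lt_n2 := leq_trans lt_n3 le32; have lt_n1 := leq_trans lt_n2 le21.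
  have [u [Ox1 Ox0 ou]] := Ohm_cycle_large p_pr ox lt_n1.
  have [v [Oy1 Oy0 ov]] := Ohm_cycle_large p_pr oy lt_n2.
  have [w [Oz1 Oz0 ow]] := Ohm_cycle_large p_pr oz lt_n3.
  rewrite Ox1 Oy1 Oz1 in defO1; rewrite Ox0 Oy0 Oz0 in defO0.
  have oup := order_exp_p p_pr ou; have ovp := order_exp_p p_pr ov.
  have [G1 [defG1 cG1 ->]] :=
    index_sum0_drop p_pr cOO ou ov ow (leqnn _) (leqnn _) defO1.
  rewrite -dprodA dprodC in defG1.
  have [G2 [defG2 cG2 ->]] :=
    index_sum0_drop p_pr cG1 ov ow oup (leqnSn _) (leqnn _) defG1.
  rewrite -dprodA dprodC in defG2.
  have [G3 [defG3 _ ->]] :=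
    index_sum0_drop p_pr cG2 ow oup ovp (leqnn _) (leqnSn _) defG2.
  rewrite -dprodA dprodC defO0 in defG3.
  by rewrite -defG3 /s; ring.
- have lt_n1 := leq_trans lt_n2 le21.
  have [u [Ox1 Ox0 ou]] := Ohm_cycle_large p_pr ox lt_n1.
  have [v [Oy1 Oy0 ov]] := Ohm_cycle_large p_pr oy lt_n2.
  have Oz0 := Ohm_cycle_small p_pr oz le3n.
  have Oz1 := Ohm_cycle_small p_pr oz (leqW le3n).
  rewrite Ox1 Oy1 Oz1 in defO1; rewrite Ox0 Oy0 Oz0 in defO0.
  have oup := order_exp_p p_pr ou.
  have [G1 [defG1 cG1 ->]] :=
    index_sum0_drop p_pr cOO ou ov oz (leqW le3n) (leqnn _) defO1.
  rewrite [_ \x <[v]>]dprodC in defG1.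
  have [G2 [defG2 _ ->]] :=
    index_sum0_drop p_pr cG1 ov oup oz le3n (leqnSn _) defG1.
  rewrite [<[_]> \x <[_]>]dprodC defO0 in defG2.
  by rewrite -defG2 /s; ring.
have [u [Ox1 Ox0 ou]] := Ohm_cycle_large p_pr ox lt_n1.
have Oy0 := Ohm_cycle_small p_pr oy le2n.
have Oy1 := Ohm_cycle_small p_pr oy (leqW le2n).
have Oz0 := Ohm_cycle_small p_pr oz (leq_trans le32 le2n).
have Oz1 := Ohm_cycle_small p_pr oz (leq_trans le32 (leqW le2n)).
rewrite Ox1 Oy1 Oz1 in defO1; rewrite Ox0 Oy0 Oz0 in defO0.
have [G1 [defG1 _ ->]] :=
  index_sum0_drop p_pr cOO ou oy oz le32 (leqW le2n) defO1.
by rewrite -defG1 defO0 /s; ring.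
Qed.

Lemma external_dprod gT1 gT2 :
  (@pairg1 gT1 gT2 @* setT) \x (@pair1g gT1 gT2 @* setT) = [set: gT1 * gT2].
Proof.
rewrite morphim_pairg1 morphim_pair1g setX_dprod.
by apply/setP => u; rewrite !inE.
Qed.

Lemma Glambda_generators p l1 l2 l3 :
    prime p -> (0 < l1)%N -> (0 < l2)%N -> (0 < l3)%N ->
  exists x y z : Glambda p l1 l2 l3,
    [/\ #[x] = (p ^ l1)%N, #[y] = (p ^ l2)%N, #[z] = (p ^ l3)%N
      & <[x]> \x <[y]> \x <[z]> = [set: Glambda p l1 l2 l3]].
Proof.
move=> p_pr l1_gt0 l2_gt0 l3_gt0.
have order_Zp l : (0 < l)%N -> #[(Zp1 : 'Z_(p ^ l))] = (p ^ l)%N.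
  move=> l_gt0; rewrite order_Zp1 Zp_cast // -[1%N](expn0 p) ltn_exp2l //.
  exact: prime_gt1.
have Zp_gen l : <[(Zp1 : 'Z_(p ^ l))]> = setT by rewrite -Zp_cycle.
exists (pairg1 _ (pairg1 _ (Zp1 : 'Z_(p ^ l1)))).
exists (pairg1 _ (pair1g _ (Zp1 : 'Z_(p ^ l2)))).
exists (pair1g _ (Zp1 : 'Z_(p ^ l3))); split.
- by rewrite !order_injm ?injm_pairg1 ?inE ?order_Zp.
- by rewrite !order_injm ?injm_pair1g ?injm_pairg1 ?inE ?order_Zp.
- by rewrite order_injm ?injm_pair1g ?inE ?order_Zp.
rewrite -!morphim_cycle ?inE // !Zp_gen.
by rewrite (injm_dprod _ (injm_pairg1 _ _) (external_dprod _ _)) ?external_dprod.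
Qed.

End ClosedForms.

Local Open Scope ring_scope.

Theorem proposition2p2 (p l1 l2 l3 i : nat) (p_prime : prime p)
    (l3_ge1 : (1 <= l3)%N) (l32 : (l3 <= l2)%N) (l21 : (l2 <= l1)%N) :
  let N : rat := #|subgroups_of_exponent [set: Glambda p l1 l2 l3]%G (p ^ i)|%:R in
  let q : rat := p%:R in
  [/\ (1 <= i <= l3)%N ->
      N = (q ^+ (2 * i - 1) *
             ((i%:R + 1) * q ^+ 4 + (i%:R - 1) * q ^+ 3 - q ^+ 2
                - (i%:R + 2) * q - i%:R) + 3)
          / ((q ^+ 2 - 1) * (q - 1)),
      (l3 < i <= l2)%N ->
      N = ((l3%:R + 1) * q ^+ (l3 + i) * (q ^+ 2 - 1) * (q + 1)
             - 2 * q ^+ (2 * l3 + 2) + 2)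
          / ((q ^+ 2 - 1) * (q - 1))
    & (l2 < i <= l1)%N ->
      N = ((l3%:R + 1) * q ^+ (l2 + l3 + 1) * (q ^+ 2 - 1)
             - q ^+ (2 * l3 + 2) + 1)
          / ((q ^+ 2 - 1) * (q - 1))].
Proof.
case: i => [|n] N q; first by split.
have [q2 q1] := denom_neq0 p_prime; rewrite -/q in q1 q2.
have l2_gt0 := leq_trans l3_ge1 l32; have l1_gt0 := leq_trans l2_gt0 l21.
have [x [y [z [ox oy oz defG]]]] :=
  Glambda_generators p_prime l1_gt0 l2_gt0 l3_ge1.
have [E1 E2 E3] := card_exponent_rank3 n p_prime ox oy oz l32 l21 defG.
split=> [/andP[_ le_il] | le_i | le_i].
- have -> : N = _ := E1 le_il; rewrite /rank2_sum -/q -[n.+1%:R]natr1.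
  rewrite !mul2n -!addnn !(addnS, addSn) subn1 !addn0 !exprS !exprD.
  by field; rewrite q1.
- have -> : N = _ := E2 le_i; rewrite /rank2_sum -/q.
  rewrite !mul2n -!addnn !(addnS, addSn) !addn0 !exprS !exprD.
  by field; rewrite q1.
- exact: E3 le_i.
Qed.
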